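(* There is an interpretation of $L(\mathbb{I})$ in $W(\mathbb{I})$ whose coordinate map $\mathcal{P}_{\mathrm{fci}}(\mathbb{I})\to\mathcal{P}_{\mathrm{fin}}(\mathbb{I})^2$ is $A\mapsto(A_l,A_r)$. That is, this map is injective, its image is a definable subset of $W(\mathbb{I})^2$, and for every atomic $\mathcal{L}_L$-formula $\phi(X_1,\dots,X_n)$ there is an $\mathcal{L}_W$-formula $\psi(Y_1,Z_1,\dots,Y_n,Z_n)$ such that for all $A_1,\dots,A_n\in\mathcal{P}_{\mathrm{fci}}(\mathbb{I})$, $L(\mathbb{I})\models\phi(A_1,\dots,A_n)$ iff $W(\mathbb{I})\models\psi((A_1)_l,(A_1)_r,\dots,(A_n)_l,(A_n)_r)$.
   Context: $\mathbb{I}$ is a fixed dense linear order with a least element, denoted $0$, and no greatest element; $\mathcal{P}_{\mathrm{fin}}(\mathbb{I})$ is the set of finite subsets. $\mathcal{L}_{W}=\{\cup,\cap,\bot,\mathbf{0},\min,\max,\mathfrak{s}^{-1}\}$ (binary $\cup,\cap$; constants $\bot,\mathbf{0}$; unary $\min,\max$; binary $\mathfrak{s}^{-1}$). $W(\mathbb{I})$ is the $\mathcal{L}_W$-structure with universe $\mathcal{P}_{\mathrm{fin}}(\mathbb{I})$, $\cup,\cap$ union and intersection, $\bot=\emptyset$, $\mathbf{0}=\{0\}$, $\min(A),\max(A)$ the singletons of the least/greatest element of nonempty $A$ (both $\emptyset$ at $\emptyset$), and $\mathfrak{s}^{-1}(A,B)=\{i\in A: i$ has a successor $s_A(i)$ in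 $A$ and $s_A(i)\in B\}$. A closed interval of $\mathbb{I}$ is $[i,j]$, $[i,+\infty)$ or $(-\infty,j]$; $\mathcal{P}_{\mathrm{fci}}(\mathbb{I})$ is the set of finite unions of closed intervals. For $A\in\mathcal{P}_{\mathrm{fci}}(\mathbb{I})$, writing $A$ as the union of its finitely many maximal convex subsets, $A_l$ is the set of their least elements and $A_r$ the set of greatest elements of those that have one. $\mathcal{L}_L=\{\cup,\cap,\bot,\mathbf{0},\min,\max,l,r\}$; $L(\mathbb{I})$ is the $\mathcal{L}_L$-structure with universe $\mathcal{P}_{\mathrm{fci}}(\mathbb{I})$, $\cup,\cap$ union and intersection, $\bot=\emptyset$, $\mathbf{0}=\{0\}$, $\min(A)$ the singleton of the least element ($\emptyset$ for $A=\emptyset$), $\max(A)$ the singleton of the greatest element if $A$ is nonempty and bounded above and $\emptyset$ otherwise, $l(A)=A_l$, $r(A)=A_r$. *)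

(* Defs.v *)
From mathcomp Require Import all_boot all_order all_algebra finmap.
From mathcomp Require Import boolp classical_sets functions cardinality.

Set Implicit Arguments.
Unset Strict Implicit.
Unset Printing Implicit Defensive.
Import Order.TTheory.

(** * First-order logic *)

Record language := Language {
  fun_sym : Type; fun_arity : fun_sym -> nat;
  rel_sym : Type; rel_arity : rel_sym -> nat }.

Record structure (L : language) := Structure {
  universe :> Type;
  fun_interp : forall f : fun_sym L, ('I_(fun_arity f) -> universe) -> universe;
  rel_interp : forall r : rel_sym L, ('I_(rel_arity r) -> universe) -> Prop }.

(* The free variables of a term or formula are the elements of a type [V];
   inside a quantifier [None] is the bound variable. *)
Inductive term (L : language) (V : Type) : Type :=
| Var of V
| App (f : fun_sym L) of ('I_(fun_arity f) -> term L V).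

Inductive formula (L : language) (V : Type) : Type :=
| Equal of term L V & term L V
| Rel (r : rel_sym L) of ('I_(rel_arity r) -> term L V)
| Not of formula L V
| And of formula L V & formula L V
| Or of formula L V & formula L V
| Imp of formula L V & formula L V
| Forall of formula L (option V)
| Exists of formula L (option V).

Definition is_atomic L (V : Type) (phi : formula L V) : bool :=
  match phi with Equal _ _ | Rel _ _ => true | _ => false end.

Fixpoint eval L (M : structure L) (V : Type) (e : V -> M) (t : term L V) : M :=
  match t with
  | Var v => e v
  | App f args => fun_interp (fun i => eval e (args i))
  end.

Definition extend (M V : Type) (e : V -> M) (x : M) : option V -> M :=
  fun v => if v is Some w then e w else x.

Fixpoint holds L (M : structure L) (V : Type) (phi : formula L V) : (V -> M) -> Prop :=
  match phi with
  | Equal t u => fun e => eval e t = eval e u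
  | Rel r args => fun e => rel_interp (fun i => eval e (args i))
  | Not p => fun e => ~ holds p e
  | And p q => fun e => holds p e /\ holds q e
  | Or p q => fun e => holds p e \/ holds q e
  | Imp p q => fun e => holds p e -> holds q e
  | Forall p => fun e => forall x : M, holds p (extend e x)
  | Exists p => fun e => exists x : M, holds p (extend e x)
  end.

(* Definability is without parameters. *)
Definition definable L (N : structure L) k (S : set (k.-tuple N)) : Prop :=
  exists phi : formula L 'I_k,
    forall t : k.-tuple N, S t <-> holds phi (tnth t).

(* The variable [(i, j)] of [psi] stands for the [j]-th coordinate of the
   [i]-th argument. *)
Definition is_interpretation L L' (M : structure L) (N : structure L') k
    (c : M -> k.-tuple N) : Prop :=
  [/\ injective c,
      definable (range c)
    & forall n (phi : formula L 'I_n), is_atomic phi ->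
      exists psi : formula L' ('I_n * 'I_k), forall a : 'I_n -> M,
        holds phi a <-> holds psi (fun p => tnth (c (a p.1)) p.2)].

(** * The structure W(I) *)

Variant W_sym := Wcup | Wcap | Wbot | Wzero | Wmin | Wmax | Wsinv.

Definition W_arity (f : W_sym) : nat :=
  match f with
  | Wcup | Wcap | Wsinv => 2
  | Wbot | Wzero => 0
  | Wmin | Wmax => 1
  end.

Definition L_W : language :=
  @Language W_sym W_arity void (fun r => match r with end).

Section W.
Context {d : Order.disp_t} {I : bOrderType d}.
Local Open Scope order_scope.
Local Open Scope fset_scope.
Implicit Types A B : {fset I}.

Definition fmin A : {fset I} := [fset i in A | all (fun j => i <= j) A].
Definition fmax A : {fset I} := [fset i in A | all (fun j => j <= i) A].

Definition is_succ A (i j : I) : Prop :=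
  [/\ i \in A, j \in A, i < j & forall k, k \in A -> i < k -> j <= k].

Definition fsinv A B : {fset I} :=
  [fset i in A | `[< exists2 j, is_succ A i j & j \in B >]].

Definition W_interp (f : W_sym) : ('I_(W_arity f) -> {fset I}) -> {fset I} :=
  match f return ('I_(W_arity f) -> {fset I}) -> {fset I} with
  | Wcup => fun a => a ord0 `|` a ord_max
  | Wcap => fun a => a ord0 `&` a ord_max
  | Wbot => fun=> fset0
  | Wzero => fun=> [fset \bot]
  | Wmin => fun a => fmin (a ord0)
  | Wmax => fun a => fmax (a ord0)
  | Wsinv => fun a => fsinv (a ord0) (a ord_max)
  end.

End W.

Definition W_struct d (I : bOrderType d) : structure L_W :=
  @Structure L_W {fset I} W_interp (fun r => match r with end).

(** * The structure L(I) *)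

Variant L_sym := Lcup | Lcap | Lbot | Lzero | Lmin | Lmax | Ll | Lr.

Definition L_arity (f : L_sym) : nat :=
  match f with
  | Lcup | Lcap => 2
  | Lbot | Lzero => 0
  | Lmin | Lmax | Ll | Lr => 1
  end.

Definition L_L : language :=
  @Language L_sym L_arity void (fun r => match r with end).

Section L.
Context {d : Order.disp_t} {I : bOrderType d}.
Local Open Scope order_scope.
Local Open Scope classical_set_scope.
Implicit Types (A B C : set I) (J K : interval I).

(* [i, j], [i, +oo) or (-oo, j]; the empty [i, j] with [j < i] is harmless
   since [fci] allows the empty union. *)
Definition closed_itv J : bool :=
  match J with
  | Interval (BSide true _) (BSide false _)
  | Interval (BSide true _) (BInfty false)
  | Interval (BInfty true) (BSide false _) => true
  | _ => false
  end.

Definition fci : set (set I) := [set A |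
  exists2 s : seq (interval I), all closed_itv s &
    A = \bigcup_(J in [set` s]) [set` J]].

(* Each has at most one element; for [A] in [fci], [greatest A] is nonempty
   exactly when [A] is nonempty and bounded above. *)
Definition least A : set I := A `&` lbound A.
Definition greatest A : set I := A `&` ubound A.

Definition convex A : Prop :=
  forall x y z, A x -> A z -> x <= y -> y <= z -> A y.

Definition max_convex A C : Prop :=
  [/\ C `<=` A, convex C &
      forall D, D `<=` A -> convex D -> C `<=` D -> D = C].

Definition left_ends A : set I := \bigcup_(C in max_convex A) least C.
Definition right_ends A : set I := \bigcup_(C in max_convex A) greatest C.

Lemma fci0 : fci set0.
Proof. by exists [::] => //; rewrite set_nil bigcup_set0. Qed.

Lemma fciU A B : fci A -> fci B -> fci (A `|` B).
Proof.
move=> [s hs ->] [t ht ->]; exists (s ++ t); first by rewrite all_cat hs.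
rewrite -bigcup_setU; congr (\bigcup_(_ in _) _).
by apply/seteqP; split=> x /=; rewrite mem_cat => /orP.
Qed.

Lemma closed_itvI J K : closed_itv J -> closed_itv K ->
  closed_itv (J `&` K)%O.
Proof.
case: J => [[[] a|[]] [[] b|[]]] //; case: K => [[[] a'|[]] [[] b'|[]]] //= _ _;
by rewrite ?orbT ?andbF.
Qed.

Lemma fciI A B : fci A -> fci B -> fci (A `&` B).
Proof.
move=> [s /allP hs ->] [t /allP ht ->].
exists [seq (J `&` K)%O | J <- s, K <- t].
  by apply/allP => _ /allpairsP[[J K] /= [/hs hJ /ht hK ->]]; exact: closed_itvI.
apply/seteqP; split=> [x [[J /= sJ Jx] [K /= tK Kx]]|x [L /=]].
  exists (J `&` K)%O; first exact: allpairs_f.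
  by rewrite /= in_itvI Jx.
move=> /allpairsP[[J K] /= [sJ tK ->]]; rewrite in_itvI => /andP[Jx Kx].
by split; [exists J|exists K].
Qed.

Lemma finite_fci A : finite_set A -> fci A.
Proof.
move=> /finite_seqP[s ->]; exists [seq `[i, i]%R | i <- s].
  by apply/allP => _ /mapP[i _ ->].
apply/seteqP; split=> [x /= sx|x [_ /= /mapP[i si ->]]].
  by exists `[x, x]%R; [exact: map_f|rewrite /= in_itv /= lexx].
by rewrite in_itv /= -eq_le => /eqP <-.
Qed.

Lemma finite_least A : finite_set (least A).
Proof.
have [[x [Ax xA]]|/forallNP A0] := pselect (exists x, least A x); last first.
  by rewrite (_ : least A = set0) //; apply/seteqP; split=> // x /A0.
apply: sub_finite_set (finite_set1 x) => y [Ay yA] /=.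
by apply: le_anti; rewrite yA ?xA.
Qed.

Lemma finite_greatest A : finite_set (greatest A).
Proof.
have [[x [Ax xA]]|/forallNP A0] := pselect (exists x, greatest A x); last first.
  by rewrite (_ : greatest A = set0) //; apply/seteqP; split=> // x /A0.
apply: sub_finite_set (finite_set1 x) => y [Ay yA] /=.
by apply: le_anti; rewrite yA ?xA.
Qed.

Lemma max_convex_absorb A C D x :
  max_convex A C -> D `<=` A -> convex D -> C x -> D x -> D `<=` C.
Proof.
move=> [CA cC Cmax] DA cD Cx Dx.
rewrite -(Cmax (C `|` D)) => [y Dy||y z t|y Cy]; [by right| | |by left].
  by move=> y [/CA|/DA].
move=> Hy Ht yz zt; have [zx|/ltW xz] := leP z x.
  by case: Hy => [Cy|Dy]; [left; exact: (cC y z x)|right; exact: (cD y z x)].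
by case: Ht => [Ct|Dt]; [left; exact: (cC x z t)|right; exact: (cD x z t)].
Qed.

Lemma convex_itv J : closed_itv J -> convex [set` J].
Proof.
case: J => [[[] a|[]] [[] b|[]]] // _ x y z /=; rewrite !in_itv /=.
- by move=> /andP[ax _] /andP[_ zb] /(le_trans ax)-> /le_trans->.
- by rewrite !andbT => ax _ /(le_trans ax).
- by move=> _ zb _ /le_trans->.
Qed.

Lemma finite_left_ends A : fci A -> finite_set (left_ends A).
Proof.
move=> [s /allP hs defA].
apply: (@sub_finite_set _ _
  [set` [seq (if J is Interval (BSide true a) _ then a else \bot) | J <- s]]);
  last exact: finite_seq.
move=> x [C mC [Cx lx]] /=; have [CA _ _] := mC.
have := CA x Cx; rewrite defA => -[J /= sJ Jx]; apply/mapP; exists J => //.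
have JC : [set` J] `<=` C.
  apply: (max_convex_absorb mC _ (convex_itv (hs J sJ)) Cx Jx).
  by rewrite defA => y Jy; exists J.
have hJ := hs J sJ; case: J hJ {sJ} Jx JC => [[[] a|[]] [[] b|[]]] // _ /=;
  rewrite in_itv /= ?andbT => Jx JC; apply: le_anti; rewrite ?le0x ?andbT.
- case/andP: Jx => ax xb; rewrite ax andbT; apply: lx; apply: JC => /=.
  by rewrite in_itv /= lexx (le_trans ax).
- rewrite Jx andbT; apply: lx; apply: JC => /=.
  by rewrite in_itv /= lexx.
- by apply: lx; apply: JC; rewrite /= in_itv /= le0x.
Qed.

Lemma finite_right_ends A : fci A -> finite_set (right_ends A).
Proof.
move=> [s /allP hs defA].
apply: (@sub_finite_set _ _ (\bigcup_(J in [set` s]) greatest [set` J]));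
  last by apply: bigcup_finite => // J _; exact: finite_greatest.
move=> x [C mC [Cx ux]] /=; have [CA _ _] := mC.
have := CA x Cx; rewrite defA => -[J /= sJ Jx]; exists J => //; split=> //.
move=> y Jy; apply: ux; apply: (@max_convex_absorb A C [set` J] x) => //.
  by rewrite defA => z Jz; exists J.
exact/convex_itv/hs.
Qed.

Definition mk_fci A (fA : fci A) : fci := exist _ A (mem_set fA).

Lemma fciP (A : fci) : fci (val A).
Proof. exact: set_mem (valP A). Qed.

Definition L_interp (f : L_sym) : ('I_(L_arity f) -> fci) -> fci :=
  match f return ('I_(L_arity f) -> fci) -> fci with
  | Lcup => fun a => mk_fci (fciU (fciP (a ord0)) (fciP (a ord_max)))
  | Lcap => fun a => mk_fci (fciI (fciP (a ord0)) (fciP (a ord_max)))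
  | Lbot => fun=> mk_fci fci0
  | Lzero => fun=> mk_fci (finite_fci (finite_set1 \bot))
  | Lmin => fun a => mk_fci (finite_fci (finite_least (val (a ord0))))
  | Lmax => fun a => mk_fci (finite_fci (finite_greatest (val (a ord0))))
  | Ll => fun a => mk_fci (finite_fci (finite_left_ends (fciP (a ord0))))
  | Lr => fun a => mk_fci (finite_fci (finite_right_ends (fciP (a ord0))))
  end.

End L.

Definition L_struct d (I : bOrderType d) : structure L_L :=
  @Structure L_L (@fci d I) L_interp (fun r => match r with end).

(* [fset_set] is faithful here by [finite_left_ends] and
   [finite_right_ends]. *)
Definition ends d (I : bOrderType d) (A : L_struct I) : 2.-tuple (W_struct I) :=
  [tuple fset_set (left_ends (val A)); fset_set (right_ends (val A))].

(* Main.v *)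
(** The set [A] is recovered from its endpoints: [i] lies in [A] iff some left
    endpoint [l <= i] has no right endpoint in [[l, i)].  The same recipe turns
    any pair of finite sets into a finite union of closed intervals, so the
    image of the coordinate map consists of the pairs that are the endpoints of
    the set they describe.  A point [i] is coded in [W(I)] by the singleton
    [{i}], and [i <= j] by [min({i} U {j}) = {i}]; every operation of [L(I)],
    including [l] and [r], is first-order over the order in terms of
    membership of points. *)

Require Import Defs.
From mathcomp Require Import all_boot all_order interval.
From mathcomp Require Import finmap boolp classical_sets functions cardinality.

Set Implicit Arguments.
Unset Strict Implicit.
Unset Printing Implicit Defensive.
Import Order.TTheory.

(** * Renaming of variables in terms and formulas *)

Section Renaming.
Context {L : language}.

Fixpoint term_map V V' (s : V -> V') (t : term L V) : term L V' :=
  match t with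
  | Var v => Var L (s v)
  | App f args => App (fun i => term_map s (args i))
  end.

Fixpoint formula_map V V' (s : V -> V') (phi : formula L V) : formula L V' :=
  match phi with
  | Equal t u => Equal (term_map s t) (term_map s u)
  | Rel r args => Rel (fun i => term_map s (args i))
  | Not p => Not (formula_map s p)
  | And p q => And (formula_map s p) (formula_map s q)
  | Or p q => Or (formula_map s p) (formula_map s q)
  | Imp p q => Imp (formula_map s p) (formula_map s q)
  | Forall p => Forall (formula_map (omap s) p)
  | Exists p => Exists (formula_map (omap s) p)
  end.

Variable M : structure L.

Lemma eval_map V V' (s : V -> V') (t : term L V) (e : V' -> M) :
  eval e (term_map s t) = eval (e \o s) t.
Proof.
by elim: t => //= f args IH; congr fun_interp; apply/funext => i; exact: IH.
Qed.

Lemma extend_omap V V' (s : V -> V') (e : V' -> M) x :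
  extend e x \o omap s = extend (e \o s) x.
Proof. by apply/funext => -[]. Qed.

(** The target type, the renaming and the environment stay general in the induction, because passing
    under a quantifier replaces [V] by [option V] and [s] by [omap s]. *)
Lemma holds_map V (phi : formula L V) : forall V' (s : V -> V') (e : V' -> M),
  holds (formula_map s phi) e <-> holds phi (e \o s).
Proof.
elim: phi => {V} [V t u|V r args|V p IHp|V p IHp q IHq|V p IHp q IHq
  |V p IHp q IHq|V p IHp|V p IHp] V' s e /=.
- by rewrite !eval_map.
- by under [X in rel_interp X]eq_fun do rewrite eval_map.
- by rewrite IHp.
- by rewrite IHp IHq.
- by rewrite IHp IHq.
- by rewrite IHp IHq.
- by split=> H x; move: (H x); rewrite IHp extend_omap.
- by split=> -[x H]; exists x; move: H; rewrite IHp extend_omap.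
Qed.

End Renaming.

(** * Convex components and endpoints of finite unions of closed intervals *)

Section Ends.
Context {d : Order.disp_t} {I : bOrderType d}.
Local Open Scope order_scope.
Local Open Scope classical_set_scope.
Implicit Types (A C D Y Z : set I) (i j k l r x y z : I).

Definition component A x : set I :=
  \bigcup_(D in [set D | [/\ D `<=` A, convex D & D x]]) D.

Lemma component_refl A x : A x -> component A x x.
Proof.
move=> Ax; exists [set x] => //; split=> //; first by move=> y ->.
by move=> y z t /= -> -> xz zx; apply: le_anti; rewrite xz zx.
Qed.

(** The union is convex because all its members share [x]: a point between a point of [D] and a
    point of [E] lies in [D] if it is at most [x], and in [E] otherwise. *)
Lemma max_convex_component A x : A x -> max_convex A (component A x).
Proof.
move=> Ax; split.
- by move=> y [D [DA _ _]] /DA.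
- move=> y z t [D [DA cD Dx] Dy] [E [EA cE Ex] Et] yz zt.
  have [zx|/ltW xz] := leP z x.
    by exists D => //; exact: (cD y z x).
  by exists E => //; exact: (cE x z t).
- move=> D DA cD sD; apply/seteqP; split=> // y Dy.
  by exists D => //; split=> //; apply: sD; exact: component_refl.
Qed.

Lemma convex_segment x y : convex [set z | x <= z /\ z <= y].
Proof.
move=> a b c [xa _] [_ cy] ab bc.
by split; [exact: le_trans ab|exact: le_trans cy].
Qed.

(** The definition of [left_ends] quantifies over sets of points; this form quantifies over points
    only, so it can be expressed in [W(I)]. If [A] contained a whole segment [[j, i]] with [j < i],
    the maximal convex set with least element [i] would absorb it. *)
Lemma left_endsE A i : left_ends A i <->
  A i /\ forall j, j < i -> exists k, [/\ j <= k, k < i & ~ A k].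
Proof.
split=> [[C mC [Ci lbi]]|[Ai H]].
  have [CA _ _] := mC; split=> [|j ji]; first exact: CA.
  apply: contrapT => /forallNP Hk; suff /lbi : C j by rewrite leNgt ji.
  apply: (max_convex_absorb mC _ (@convex_segment j i) Ci) => /=;
    rewrite ?lexx ?(ltW ji) // => k [jk].
  rewrite le_eqVlt => /predU1P[->|ki]; first exact: CA.
  by apply: contrapT => Ak; apply: (Hk k).
have mC := max_convex_component Ai; exists (component A i) => //.
have Ci := component_refl Ai; split=> // y Cy; rewrite leNgt; apply/negP => yi.
have [CA cC _] := mC; have [k [yk ki []]] := H _ yi.
by apply/CA/(cC y k i) => //; exact: ltW.
Qed.

Lemma right_endsE A i : right_ends A i <->
  A i /\ forall j, i < j -> exists k, [/\ i < k, k <= j & ~ A k].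
Proof.
split=> [[C mC [Ci ubi]]|[Ai H]].
  have [CA _ _] := mC; split=> [|j ij]; first exact: CA.
  apply: contrapT => /forallNP Hk; suff /ubi : C j by rewrite leNgt ij.
  apply: (max_convex_absorb mC _ (@convex_segment i j) Ci) => /=;
    rewrite ?lexx ?(ltW ij) // => k [+ kj].
  rewrite le_eqVlt => /predU1P[<-|ik]; first exact: CA.
  by apply: contrapT => Ak; apply: (Hk k).
have mC := max_convex_component Ai; exists (component A i) => //.
have Ci := component_refl Ai; split=> // y Cy; rewrite leNgt; apply/negP => iy.
have [CA cC _] := mC; have [k [ik ky []]] := H _ iy.
by apply/CA/(cC i k y) => //; exact: ltW.
Qed.

Lemma fci_itv (J : interval I) : closed_itv J -> fci [set` J].
Proof.
by move=> cJ; exists [:: J]; [rewrite /= cJ|rewrite set_cons1 bigcup_set1].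
Qed.

(** An interval of the union that meets [C] is absorbed by [C], so [C] is the union of those listed
    intervals that it contains. Components thus have the extremal elements provided by the next
    lemmas. *)
Lemma fci_max_convex A C : fci A -> max_convex A C -> fci C.
Proof.
move=> [s /allP cs defA] mC; have [CA _ _] := mC.
exists [seq J <- s | `[< [set` J] `<=` C >]].
  by apply/allP => J; rewrite mem_filter => /andP[_ /cs].
apply/seteqP; split=> [x Cx|x [J /=]]; last first.
  by rewrite mem_filter => /andP[/asboolP JC _] /JC.
have := CA _ Cx; rewrite defA => -[J /= sJ Jx]; exists J => //=.
rewrite mem_filter sJ andbT; apply/asboolP.
apply: (max_convex_absorb mC _ (convex_itv (cs _ sJ)) Cx Jx).
by rewrite defA => y Jy; exists J.
Qed.

Lemma bigcup_itv_cons (J : interval I) s :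
  \bigcup_(K in [set` J :: s]) [set` K] =
  [set` J] `|` \bigcup_(K in [set` s]) [set` K].
Proof.
rewrite -(bigcup_setU1 (fun K : interval I => [set` K])); congr bigcup.
by apply/seteqP; split=> K /=; rewrite in_cons => /predU1P.
Qed.

Lemma fci_least A x : fci A -> A x -> exists l, least A l.
Proof.
move=> [s + ->]; elim: s x => [|J s IH] x /=; first by move=> _ [].
move=> /andP[cJ cs]; rewrite bigcup_itv_cons.
have leastJ y : [set` J] y -> exists l, least [set` J] l.
  case: J cJ => [[[] a|[]] [[] b|[]]] // _; rewrite /= in_itv /= ?andbT => Jy.
  - have ab : a <= b by case/andP: Jy; exact: le_trans.
    by exists a; split=> [|z] /=; rewrite in_itv /= ?lexx // => /andP[].
  - by exists a; split=> [|z] /=; rewrite in_itv /= ?lexx // andbT.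
  - by exists \bot; split=> [|z] /=; rewrite ?in_itv /= ?le0x.
set U := \bigcup_(_ in _) _ in IH *; have {}IH y := IH y cs.
(* Both the head interval and the rest of the union may be empty, so the smaller of two least
   elements is taken only when both have a point. *)
have [[y /leastJ[l [Jl Hl]]]|/forallNP J0] := pselect (exists y, [set` J] y);
  have [[z /IH[m [Um Hm]]]|/forallNP U0] := pselect (exists z, U z).
- move=> _; have [lm|/ltW ml] := leP l m.
    exists l; split; first by left.
    by move=> t [/Hl//|/Hm]; exact: le_trans.
  exists m; split; first by right.
  by move=> t [/Hl|/Hm//]; exact: le_trans.
- by move=> _; exists l; split; [left|move=> t [/Hl//|/U0]].
- by move=> _; exists m; split; [right|move=> t [/J0//|/Hm]].
- by case=> [/J0|/U0].
Qed.

Lemma fci_greatest A x b : fci A -> A x -> ubound A b -> exists r, greatest A r.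
Proof.
move=> [s + ->]; elim: s x => [|J s IH] x /=; first by move=> _ [].
move=> /andP[cJ cs]; rewrite bigcup_itv_cons.
set U := \bigcup_(_ in _) _ in IH *; move=> + ub.
have ubJ y : [set` J] y -> y <= b by move=> Jy; apply: ub; left.
have ubU : ubound U b by move=> y Uy; apply: ub; right.
have {}IH y Uy := IH y cs Uy ubU; clear ub.
have greatestJ y : [set` J] y -> exists r, greatest [set` J] r.
  case: J cJ ubJ => [[[] a|[]] [[] c|[]]] // _ ubJ;
    rewrite /= in_itv /= ?andbT => Jy.
  - have ac : a <= c by case/andP: Jy; exact: le_trans.
    by exists c; split=> [|z] /=; rewrite in_itv /= ?lexx ?andbT // => /andP[].
  (* An upper bound [b] of the ray [[a, +oo)] lies in the ray, so it is its greatest element. *)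
  - exists b; split=> //=; rewrite in_itv /= andbT (le_trans Jy) // ubJ //=.
    by rewrite in_itv /= Jy.
  - by exists c; split=> [|z] /=; rewrite in_itv /=.
have [[y /greatestJ[l [Jl Hl]]]|/forallNP J0] := pselect (exists y, [set` J] y);
  have [[z /IH[m [Um Hm]]]|/forallNP U0] := pselect (exists z, U z).
- move=> _; have [lm|/ltW ml] := leP l m.
    exists m; split; first by right.
    by move=> t [/Hl tl|/Hm//]; exact: le_trans lm.
  exists l; split; first by left.
  by move=> t [/Hl//|/Hm tm]; exact: le_trans ml.
- by move=> _; exists l; split; [left|move=> t [/Hl//|/U0]].
- by move=> _; exists m; split; [right|move=> t [/J0//|/Hm]].
- by case=> [/J0|/U0].
Qed.

Definition hull Y Z : set I := [set i | exists l,
  [/\ Y l, l <= i & forall r, Z r -> l <= r -> i <= r]].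

Lemma hull_ends A : fci A -> hull (left_ends A) (right_ends A) = A.
Proof.
move=> fA; apply/seteqP; split=> [i [l [[C mC [Cl lbl]] li H]]|i Ai].
  (* A point [i >= l] outside the component [C] of [l] bounds [C] above by convexity. Then [C] has a
     greatest element [r], which is a right end, so [l <= i <= r] forces [i] into [C] after all. *)
  have [CA cC _] := mC; apply: CA; apply: contrapT => Ci.
  have ubi : ubound C i.
    move=> y Cy; rewrite leNgt; apply/negP => iy.
    by apply/Ci/(cC l i y) => //; exact: ltW.
  have [r [Cr ubr]] := fci_greatest (fci_max_convex fA mC) Cl ubi.
  apply: Ci; apply: (cC l i r) => //; apply: H; last exact: ubr.
  by exists C.
(* Conversely, the least element [l] of the component of [i] is the witness: a right end [r] with
   [l <= r < i] would lie in that component and be the greatest element of it, contradicting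
   [r < i]. *)
have mC := max_convex_component Ai; have Ci := component_refl Ai.
have [l [Cl lbl]] := fci_least (fci_max_convex fA mC) Ci.
have [CA cC _] := mC; exists l; split; first by exists (component A i).
  exact: lbl.
move=> r [C' mC' [C'r ubr]] lr; rewrite leNgt; apply/negP => ri.
have Cr : component A i r by apply: (cC l r i) => //; exact: ltW.
have /ubr : C' i by exact: (max_convex_absorb mC' CA cC C'r Cr).
by rewrite leNgt ri.
Qed.

(** Each left point [l] contributes one closed interval: the ray [[l, +oo)] cut down by []-oo, r]]
    for every [r >= l] among the finitely many right points. *)
Lemma fci_hull Y Z : finite_set Y -> finite_set Z -> fci (hull Y Z).
Proof.
move=> /finite_seqP[s ->] /finite_seqP[t ->] {Y Z}.
have fci1 l :
    fci [set i | l <= i /\ forall r, r \in t -> l <= r -> i <= r].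
  elim: t => [|z t IH].
    rewrite (_ : [set i | _] = [set` `[l, +oo[%O]); first exact: fci_itv.
    apply/seteqP; split=> i /=; rewrite in_itv /= andbT; first by case.
    by move=> li; split.
  (* A right point [z < l] imposes no condition, so the set for the shorter list is unchanged. *)
  have [lz|zl] := leP l z; last first.
    rewrite (_ : [set i | _] =
      [set i | l <= i /\ forall r, r \in t -> l <= r -> i <= r]) //.
    apply/seteqP; split=> i [li H]; split=> // r.
      by move=> tr; apply: H; rewrite in_cons tr orbT.
    by rewrite in_cons => /predU1P[->|/H//]; rewrite leNgt zl.
  rewrite (_ : [set i | _] =
    [set i | l <= i /\ forall r, r \in t -> l <= r -> i <= r] `&`
    [set` `]-oo, z]%O]); first by apply: fciI => //; exact: fci_itv.
  apply/seteqP; split=> i /=; rewrite in_itv /=.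
    move=> [li H]; split; last by apply: H; rewrite ?mem_head.
    by split=> // r tr; apply: H; rewrite in_cons tr orbT.
  move=> [[li H] iz]; split=> // r.
  by rewrite in_cons => /predU1P[->|/H].
elim: s => [|x s IH].
  rewrite (_ : hull _ _ = set0); first exact: fci0.
  by apply/seteqP; split=> i // [l []].
rewrite (_ : hull _ _ =
  [set i | x <= i /\ forall r, r \in t -> x <= r -> i <= r] `|`
  hull [set` s] [set` t]); first exact: fciU.
apply/seteqP; split=> i.
  move=> [l [/= + li H]]; rewrite in_cons => /predU1P[<-|sl]; first by left.
  by right; exists l.
move=> [[xi H]|[l [/= sl li H]]].
  by exists x; split=> //=; exact: mem_head.
by exists l; split=> //=; rewrite in_cons sl orbT.
Qed.

End Ends.

(** * Predicates on points and finite sets that are expressible in [W(I)] *)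

Definition pair_arg T (x y : T) : 'I_2 -> T :=
  fun i => if val i is 0 then x else y.

Section Expressible.
Context {d : Order.disp_t} {I : bOrderType d}.
Local Open Scope order_scope.
Local Open Scope fset_scope.
Local Notation W := (W_struct I).

(* The variables [V] range over finite sets and the variables [X] over points
   of [I], coded by singletons. *)
Definition join_env V X (e : V -> W) (p : X -> I) : V + X -> W :=
  fun z => match z with inl v => e v | inr x => [fset p x] end.

(** Predicates stay semantic, and one formula must work for all environments. Closure under
    connectives and point quantifiers then replaces the explicit writing of large formulas. *)
Definition expressible V X (P : (V -> W) -> (X -> I) -> Prop) : Prop :=
  exists phi : formula L_W (V + X),
    forall e p, P e p <-> holds phi (join_env e p).

(** A set of points is represented by its membership predicate rather than by an element of [W(I)],
    since sets such as hulls may be infinite. *)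
Definition expressible_set V (Q : (V -> W) -> set I) : Prop :=
  expressible (fun e (p : unit -> I) => Q e (p tt)).

(** This makes the codes of points definable, so that quantifiers over finite sets can be
    relativized to points. *)
Lemma fmin_singleton (A : {fset I}) :
  A <> fset0 /\ fmin A = A <-> exists i, A = [fset i].
Proof.
split=> [[/eqP/fset0Pn[i Ai] mA]|[i ->]].
  have minA j : j \in A -> forall k, k \in A -> j <= k.
    by rewrite -{1}mA !inE => /andP[_ /allP].
  exists i; apply/fsetP => j; rewrite inE; apply/idP/eqP => [Aj|->//].
  by apply: le_anti; rewrite !minA.
split; first by move/fsetP/(_ i); rewrite !inE eqxx.
apply/fsetP => j; rewrite !inE /=; case: eqP => //= ->.
by apply/allP => k; rewrite inE => /eqP ->.
Qed.

Lemma fmin_pair (i j : I) : fmin ([fset i] `|` [fset j]) = [fset i] <-> i <= j.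
Proof.
split=> [/fsetP/(_ i)|ij].
  by rewrite !inE eqxx /= => /allP; apply; rewrite !inE eqxx orbT.
apply/fsetP => k; rewrite !inE /=; apply/andP/eqP => [[kij /allP H]|->].
  apply: le_anti; rewrite H ?inE ?eqxx //=.
  by case/orP: kij => /eqP ->.
by split; [rewrite eqxx|apply/allP => l; rewrite !inE => /orP[]/eqP->].
Qed.

Lemma expressible_ext V X (P P' : (V -> W) -> (X -> I) -> Prop) :
  (forall e p, P e p <-> P' e p) -> expressible P' -> expressible P.
Proof. by move=> PP' [phi H]; exists phi => e p; rewrite PP'. Qed.

Lemma expressible_not V X (P : (V -> W) -> (X -> I) -> Prop) :
  expressible P -> expressible (fun e p => ~ P e p).
Proof. by move=> [phi H]; exists (Not phi) => e p; rewrite H. Qed.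

Lemma expressible_and V X (P P' : (V -> W) -> (X -> I) -> Prop) :
  expressible P -> expressible P' -> expressible (fun e p => P e p /\ P' e p).
Proof. by move=> [f Hf] [g Hg]; exists (And f g) => e p; rewrite Hf Hg. Qed.

Lemma expressible_and3 V X (P P' P'' : (V -> W) -> (X -> I) -> Prop) :
  expressible P -> expressible P' -> expressible P'' ->
  expressible (fun e p => [/\ P e p, P' e p & P'' e p]).
Proof.
move=> hP hP' hP''.
apply: expressible_ext (expressible_and hP (expressible_and hP' hP'')) => e p.
by split=> [[]|[? []]].
Qed.

Lemma expressible_or V X (P P' : (V -> W) -> (X -> I) -> Prop) :
  expressible P -> expressible P' -> expressible (fun e p => P e p \/ P' e p).
Proof. by move=> [f Hf] [g Hg]; exists (Or f g) => e p; rewrite Hf Hg. Qed.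

Lemma expressible_imp V X (P P' : (V -> W) -> (X -> I) -> Prop) :
  expressible P -> expressible P' -> expressible (fun e p => P e p -> P' e p).
Proof. by move=> [f Hf] [g Hg]; exists (Imp f g) => e p; rewrite Hf Hg. Qed.

Lemma expressible_iff V X (P P' : (V -> W) -> (X -> I) -> Prop) :
  expressible P -> expressible P' -> expressible (fun e p => P e p <-> P' e p).
Proof. by move=> hP hP'; apply: expressible_and; exact: expressible_imp. Qed.

Lemma expressible_forall V X (P : (V -> W) -> (X -> I) -> I -> Prop) :
  expressible
    (fun e (p : option X -> I) => P e (fun x => p (Some x)) (p None)) ->
  expressible (fun e p => forall i, P e p i).
Proof.
move=> [phi H].
(* The new point variable [inr None] becomes the variable bound by the quantifier; [single]
   restricts that variable to singletons. *)
pose shift (z : V + option X) : option (V + X) :=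
  match z with
  | inl v => Some (inl v) | inr (Some x) => Some (inr x) | inr None => None
  end.
pose x0 := Var L_W (@None (V + X)).
pose single := And (Not (Equal x0 (@App L_W _ Wbot (fun=> x0))))
                   (Equal (@App L_W _ Wmin (fun=> x0)) x0).
exists (Forall (Imp single (formula_map shift phi))) => e p /=.
have holds_phi i : P e p i <->
    holds (formula_map shift phi) (@extend W _ (join_env e p) [fset i]).
  pose q (o : option X) := if o is Some x then p x else i.
  rewrite (H e q) holds_map (_ : _ \o _ = join_env e q) //.
  by apply/funext => -[v|[x|]].
split=> [HP A /fmin_singleton[i ->]|HP i]; first exact/holds_phi.
by apply/holds_phi/HP/fmin_singleton; exists i.
Qed.

Lemma expressible_exists V X (P : (V -> W) -> (X -> I) -> I -> Prop) :
  expressible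
    (fun e (p : option X -> I) => P e (fun x => p (Some x)) (p None)) ->
  expressible (fun e p => exists i, P e p i).
Proof.
move=> hP; apply: (@expressible_ext _ _ _ (fun e p => ~ forall i, ~ P e p i)).
  move=> e p; split=> [[i Pi] /(_ i)//|].
  by rewrite -existsNE => -[i /contrapT]; exists i.
apply/expressible_not/(@expressible_forall _ _ (fun e p i => ~ P e p i)).
exact: expressible_not.
Qed.

Lemma expressible_le V X (x y : X) :
  expressible (fun (_ : V -> W) p => p x <= p y).
Proof.
pose t z := Var L_W (@inr V X z).
pose cup := @App L_W _ Wcup (pair_arg (t x) (t y)).
exists (Equal (@App L_W _ Wmin (fun=> cup)) (t x)).
by move=> e p; symmetry; exact: fmin_pair.
Qed.

Lemma expressible_lt V X (x y : X) :
  expressible (fun (_ : V -> W) p => p x < p y).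
Proof.
apply: expressible_ext (expressible_not (expressible_le V y x)) => e p.
by rewrite ltNge; split=> /negP.
Qed.

(** Substituting [x] for the only point variable of [Q] lets a set be used under any number of point
    quantifiers. *)
Lemma expressible_mem V X (Q : (V -> W) -> set I) (x : X) :
  expressible_set Q -> expressible (fun e p => Q e (p x)).
Proof.
move=> [phi H].
pose s (z : V + unit) : V + X := if z is inl v then inl v else inr x.
exists (formula_map s phi) => e p; rewrite (H e (fun=> p x)) holds_map.
by rewrite (_ : _ \o _ = join_env e (fun=> p x)) //; apply/funext => -[].
Qed.

(** Once no point variable is free, the formula can be renamed to one in the set variables [V]
    alone, as the definition of an interpretation requires. *)
Lemma expressible_closed V (P : (V -> W) -> Prop) :
  expressible (fun e (_ : void -> I) => P e) ->
  exists phi : formula L_W V, forall e, P e <-> holds phi e.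
Proof.
move=> [phi H].
pose p0 (x : void) : I := match x with end.
pose s (z : V + void) : V :=
  match z with inl v => v | inr x => match x with end end.
exists (formula_map s phi) => e.
rewrite (H e p0) holds_map (_ : _ \o _ = join_env e p0) //.
by apply/funext => -[].
Qed.

Lemma expressible_set_var V (v : V) :
  expressible_set (fun e : V -> W => [set` e v]%classic).
Proof.
pose x := Var L_W (@inr V _ tt).
(* A point [x] lies in [v] exactly when [{x}] intersected with [v] is [{x}]. *)
exists (Equal (@App L_W _ Wcap (pair_arg x (Var L_W (inl v)))) x) => e p /=.
by rewrite -fsub1set; split=> [/fsetIidPl|?]; last exact/fsetIidPl.
Qed.

Lemma expressible_setI V (Q Q' : (V -> W) -> set I) :
  expressible_set Q -> expressible_set Q' ->
  expressible_set (fun e => Q e `&` Q' e)%classic.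
Proof. exact: expressible_and. Qed.

Lemma expressible_setU V (Q Q' : (V -> W) -> set I) :
  expressible_set Q -> expressible_set Q' ->
  expressible_set (fun e => Q e `|` Q' e)%classic.
Proof. exact: expressible_or. Qed.

Lemma expressible_set0 V : expressible_set (fun _ : V -> W => set0).
Proof.
apply: (expressible_ext _ (expressible_lt V tt tt)) => e p.
by rewrite ltxx.
Qed.

Lemma expressible_set1_bot V :
  expressible_set (fun _ : V -> W => [set \bot]%classic).
Proof.
apply: (@expressible_ext _ _ _ (fun _ p => forall i, p tt <= i)) => [e p|].
  split=> [-> i|H]; first exact: le0x.
  by apply: le_anti; rewrite le0x H.
by apply: expressible_forall; exact: expressible_le.
Qed.

Lemma expressible_least V (Q : (V -> W) -> set I) :
  expressible_set Q -> expressible_set (fun e => least (Q e)).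
Proof.
move=> hQ; apply: expressible_and => //; apply: expressible_forall.
by apply: expressible_imp; [exact: expressible_mem|exact: expressible_le].
Qed.

Lemma expressible_greatest V (Q : (V -> W) -> set I) :
  expressible_set Q -> expressible_set (fun e => greatest (Q e)).
Proof.
move=> hQ; apply: expressible_and => //; apply: expressible_forall.
by apply: expressible_imp; [exact: expressible_mem|exact: expressible_le].
Qed.

Lemma expressible_left_ends V (Q : (V -> W) -> set I) :
  expressible_set Q -> expressible_set (fun e => left_ends (Q e)).
Proof.
move=> hQ; apply: (expressible_ext (fun e p => left_endsE (Q e) (p tt))).
apply: expressible_and => //; apply: expressible_forall.
apply: expressible_imp; first exact: expressible_lt.
apply: expressible_exists; apply: expressible_and3.
- exact: expressible_le.
- exact: expressible_lt.
- by apply: expressible_not; exact: expressible_mem.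
Qed.

Lemma expressible_right_ends V (Q : (V -> W) -> set I) :
  expressible_set Q -> expressible_set (fun e => right_ends (Q e)).
Proof.
move=> hQ; apply: (expressible_ext (fun e p => right_endsE (Q e) (p tt))).
apply: expressible_and => //; apply: expressible_forall.
apply: expressible_imp; first exact: expressible_lt.
apply: expressible_exists; apply: expressible_and3.
- exact: expressible_lt.
- exact: expressible_le.
- by apply: expressible_not; exact: expressible_mem.
Qed.

Lemma expressible_hull V (Q Q' : (V -> W) -> set I) :
  expressible_set Q -> expressible_set Q' ->
  expressible_set (fun e => hull (Q e) (Q' e)).
Proof.
move=> hQ hQ'; apply: expressible_exists; apply: expressible_and3.
- exact: expressible_mem.
- exact: expressible_le.
apply: expressible_forall; apply: expressible_imp; first exact: expressible_mem.
by apply: expressible_imp; exact: expressible_le.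
Qed.

(** By extensionality, equality of two possibly infinite sets is a statement quantified over points,
    with no point variable left free. *)
Lemma expressible_eq V (Q Q' : (V -> W) -> set I) :
  expressible_set Q -> expressible_set Q' ->
  exists phi : formula L_W V, forall e, Q e = Q' e <-> holds phi e.
Proof.
move=> hQ hQ'; apply: expressible_closed.
apply: (@expressible_ext _ _ _
  (fun e _ => forall i, Q e i <-> Q' e i)) => [e p|].
  by split=> [->//|H]; apply/seteqP; split=> i /H.
by apply: expressible_forall; apply: expressible_iff; exact: expressible_mem.
Qed.

End Expressible.

(** * Decoding pairs of finite sets, and the interpretation *)

Section Interpretation.
Context {d : Order.disp_t} {I : bOrderType d}.
Local Notation W := (W_struct I).
Local Notation M := (L_struct I).

Lemma tnth_ends_left (A : M) :
  [set` tnth (ends A) ord0]%classic = left_ends (val A).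
Proof. by rewrite fset_setK //; exact/finite_left_ends/fciP. Qed.

Lemma tnth_ends_right (A : M) :
  [set` tnth (ends A) ord_max]%classic = right_ends (val A).
Proof. by rewrite fset_setK //; exact/finite_right_ends/fciP. Qed.

Definition fset_hull (t : 'I_2 -> {fset I}) : set I :=
  hull [set` t ord0] [set` t ord_max].

Lemma fset_hull_ends (A : M) : fset_hull (tnth (ends A)) = val A.
Proof.
by rewrite /fset_hull tnth_ends_left tnth_ends_right hull_ends //; exact: fciP.
Qed.

Lemma ends_inj : injective (@ends d I).
Proof. by move=> A B AB; apply: val_inj; rewrite -!fset_hull_ends AB. Qed.

Lemma range_endsP (t : 2.-tuple W) : range (@ends d I) t <->
  left_ends (fset_hull (tnth t)) = [set` tnth t ord0]%classic /\
  right_ends (fset_hull (tnth t)) = [set` tnth t ord_max]%classic.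
Proof.
split=> [[A _ <-]|[hl hr]].
  by rewrite fset_hull_ends tnth_ends_left tnth_ends_right.
have fA : fci (fset_hull (tnth t)) by apply: fci_hull; exact: finite_fset.
(* The preimage of a pair that satisfies both equations is its own hull. *)
exists (mk_fci fA) => //; apply: eq_from_tnth => -[[|[|//]] lt2];
  apply/fsetP => i.
  rewrite (_ : Ordinal lt2 = ord0); last exact: val_inj.
  have := congr1 (@^~ i) (tnth_ends_left (mk_fci fA)).
  by rewrite /= hl => /= /propeqP H; apply/idP/idP => /H.
rewrite (_ : Ordinal lt2 = ord_max); last exact: val_inj.
have := congr1 (@^~ i) (tnth_ends_right (mk_fci fA)).
by rewrite /= hr => /= /propeqP H; apply/idP/idP => /H.
Qed.

Lemma definable_range_ends : definable (range (@ends d I) : set (2.-tuple W)).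
Proof.
pose hullV (e : 'I_2 -> W) := fset_hull e.
have hV : expressible_set hullV.
  by apply: expressible_hull; exact: expressible_set_var.
have [f Hf] :=
  expressible_eq (expressible_left_ends hV) (expressible_set_var ord0).
have [g Hg] :=
  expressible_eq (expressible_right_ends hV) (expressible_set_var ord_max).
by exists (And f g) => t; rewrite range_endsP /= -Hf -Hg.
Qed.

(** Induction on terms. A variable is decoded from its pair of endpoint sets by [fset_hull]; from
    there on values are handled as expressible sets of points, so nested operations never need to be
    encoded again as pairs. *)
Lemma eval_expressible (V : Type) (t : term L_L V) :
  exists2 Q : (V * 'I_2 -> W) -> set I, expressible_set Q &
    forall a : V -> M,
      val (eval a t) = Q (fun p => tnth (ends (a p.1)) p.2).
Proof.
elim: t => [v|f args IH].
  exists (fun e => fset_hull (fun j => e (v, j))).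
    by apply: expressible_hull; exact: expressible_set_var.
  by move=> a; rewrite -fset_hull_ends.
case: f args IH => /= args IH; first 2 last.
- exists (fun=> set0) => //; exact: expressible_set0.
- exists (fun=> [set \bot%O]%classic) => //; exact: expressible_set1_bot.
- have [Q hQ HQ] := IH ord0; exists (fun e => least (Q e)).
    exact: expressible_least.
  by move=> a /=; rewrite HQ.
- have [Q hQ HQ] := IH ord0; exists (fun e => greatest (Q e)).
    exact: expressible_greatest.
  by move=> a /=; rewrite HQ.
- have [Q hQ HQ] := IH ord0; exists (fun e => left_ends (Q e)).
    exact: expressible_left_ends.
  by move=> a /=; rewrite HQ.
- have [Q hQ HQ] := IH ord0; exists (fun e => right_ends (Q e)).
    exact: expressible_right_ends.
  by move=> a /=; rewrite HQ.
- have [Q hQ HQ] := IH ord0; have [Q' hQ' HQ'] := IH ord_max.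
  exists (fun e => Q e `|` Q' e)%classic; first exact: expressible_setU.
  by move=> a /=; rewrite HQ HQ'.
- have [Q hQ HQ] := IH ord0; have [Q' hQ' HQ'] := IH ord_max.
  exists (fun e => Q e `&` Q' e)%classic; first exact: expressible_setI.
  by move=> a /=; rewrite HQ HQ'.
Qed.

End Interpretation.

Theorem theorem6p13 (d : Order.disp_t) (I : bOrderType d)
  (I_dense : forall x y : I, (x < y)%O -> exists z : I, (x < z)%O /\ (z < y)%O)
  (I_nomax : forall x : I, exists y : I, (x < y)%O) :
  is_interpretation (@ends d I).
Proof.
split; [exact: ends_inj|exact: definable_range_ends|].
(* The language [L_L] has no relation symbols, so an atomic formula is an equation between terms,
   and it holds when the two values agree as sets of points. *)
move=> n [t u|r args|p|p q|p q|p q|p|p] //= _; last by case: r args.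
have [Q hQ HQ] := @eval_expressible _ I _ t.
have [Q' hQ' HQ'] := @eval_expressible _ I _ u.
have [psi Hpsi] := expressible_eq hQ hQ'; exists psi => a.
by rewrite -Hpsi -HQ -HQ'; split=> [->//|/val_inj].
Qed.
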